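(* Let $P\subseteq\mathbb{R}^n$ be a polyhedron and let $f:\mathbb{R}^n\to\mathbb{R}$ be a polynomial of degree at most three. If $f$ is unbounded on $P$, then there exists a ray of $P$ on which $f$ is unbounded.
   Context: For a polyhedron $P\subseteq\mathbb{R}^n$ with recession cone $\operatorname{rec} P$, a ray of $P$ is a set $R(x,d):=\{x+\lambda d:\lambda\ge 0\}$ with $x\in P$ and $d\in\operatorname{rec}P\setminus\{0\}$. A function $f$ is unbounded on a set $S$ if $\sup_{x\in S}f(x)=+\infty$. *)

(* Defs.v *)
From mathcomp Require Import all_boot all_order all_algebra.
From mathcomp Require Import reals.
From mathcomp Require Import mpoly.

Set Implicit Arguments.
Unset Strict Implicit.
Unset Printing Implicit Defensive.
Import Order.TTheory GRing.Theory Num.Theory.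
Local Open Scope ring_scope.

Definition is_polyhedron (R : realType) (n : nat) (P : 'cV[R]_n -> Prop) :=
  exists (m : nat) (A : 'M[R]_(m, n)) (b : 'cV[R]_m),
    forall x : 'cV[R]_n, P x <-> (forall i : 'I_m, (A *m x) i 0 <= b i 0).

Definition rec_cone (R : realType) (n : nat) (P : 'cV[R]_n -> Prop) (d : 'cV[R]_n) :=
  forall x, P x -> forall lambda : R, 0 <= lambda -> P (x + lambda *: d).

Definition ray (R : realType) (n : nat) (x d : 'cV[R]_n) (y : 'cV[R]_n) :=
  exists2 lambda : R, 0 <= lambda & y = x + lambda *: d.

Definition peval (R : realType) (n : nat) (f : {mpoly R[n]}) (x : 'cV[R]_n) : R :=
  f.@[fun i => x i 0].

Definition unbounded_on (R : realType) (n : nat) (f : {mpoly R[n]})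
    (S : 'cV[R]_n -> Prop) :=
  forall M : R, exists2 x, S x & M < peval f x.

(* Main.v *)
(* Homogenizing, the polyhedron becomes the slice [tau c = 1] of a cone generated by finitely
   many vectors, so one may take coordinates [c >= 0] and [F c = T c c c] with [T] symmetric
   trilinear.  Suppose [F] is bounded above on every ray of the slice and let [c] go to infinity
   with [c / |c| -> d], keeping [F c] bounded below.  Then [T d d d = 0], and boundedness on rays
   gives [T y d d <= 0] for all [y >= 0], and [T y y d <= 0] whenever moreover [T y d d = 0].
   Splitting off the coordinates of [c] with [T e_i d d < 0] one gets [T c c d <= |c| T c d d] for
   large [c], hence [F (c - d) >= F c]: far points can be moved towards the origin by a step of
   length 1 without decreasing [F], so [F] is bounded on the slice. *)
Require Import Defs.
From mathcomp Require Import all_boot all_order all_algebra.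
From mathcomp Require Import boolp classical_sets reals.
From mathcomp Require Import mpoly ring lra.
Set Implicit Arguments.
Unset Strict Implicit.
Unset Printing Implicit Defensive.
Import Order.TTheory GRing.Theory Num.Theory.
Local Open Scope ring_scope.

(** * Finite generation of polyhedral cones *)

(* Double description: the generators violating a new constraint [a] are replaced by their
   combinations, lying on the hyperplane of [a], with the generators strictly satisfying it. *)
Lemma finitely_generated_cone (R : realFieldType) (k : nat) (s : seq 'rV[R]_k) :
  exists (I : finType) (g : I -> 'cV[R]_k), forall x : 'cV[R]_k,
    (forall a, a \in s -> (a *m x) 0 0 <= 0) <->
    (exists2 c : I -> R, (forall i, 0 <= c i) & x = \sum_i c i *: g i).
Proof.
elim: s => [|a s [I [g IH]]].
  (* Without constraints the cone is the whole space, generated by the basis vectors and their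
     opposites. *)
  exists ('I_k * bool)%type, (fun p => (if p.2 then 1 else -1) *: delta_mx p.1 0).
  move=> x; split=> [_|_ //].
  exists (fun p => Num.max 0 (if p.2 then x p.1 0 else - x p.1 0)).
    by move=> i; rewrite le_max lexx.
  rewrite -(pair_bigA _ (fun i (b : bool) => Num.max 0 (if b then x i 0 else - x i 0)
     *: ((if b then 1 else -1) *: delta_mx i 0))) /=.
  apply/matrixP => i j; rewrite ord1 summxE (bigD1 i) //= [X in _ + X]big1 => [|l li].
    rewrite big_bool !mxE !eqxx /= addr0.
    have [h|h] := lerP 0 (x i 0).
      by rewrite max_l ?oppr_le0 //; ring.
    by rewrite max_r ?oppr_ge0 ?(ltW h) //; ring.
  by rewrite big_bool !mxE eq_sym (negbTE li) /= !mulr0 addr0.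
pose al i := (a *m g i) 0 0.
pose h (p : I + I * I) := match p with
  | inl i => if al i <= 0 then g i else 0
  | inr e => if (0 < al e.1) && (al e.2 < 0) then al e.1 *: g e.2 - al e.2 *: g e.1
             else 0
  end.
have aE (J : finType) (c : J -> R) (v : J -> 'cV[R]_k) :
    (a *m (\sum_i c i *: v i)) 0 0 = \sum_i c i * (a *m v i) 0 0.
  by rewrite mulmx_sumr summxE; apply: eq_bigr => i _; rewrite -scalemxAr mxE.
have dE (b : 'rV[R]_k) (u v : R) (y z : 'cV[R]_k) :
    (b *m (u *: y - v *: z)) 0 0 = u * (b *m y) 0 0 - v * (b *m z) 0 0.
  by rewrite mulmxBr -(scalemxAr u) -(scalemxAr v) !mxE.
exists (I + I * I)%type, h => x; split=> [xs|[c c0 ->]].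
  have [|c c0 xE] := (IH x).1; first by move=> b bs; apply: xs; rewrite inE bs orbT.
  (* [p] is the total violation of [a] by the generators and [q] the total slack; [a x <= 0] amounts
     to [p <= q]. *)
  pose p := \sum_(i | 0 < al i) c i * al i.
  pose q := \sum_(j | al j < 0) c j * - al j.
  have p0 : 0 <= p by apply: sumr_ge0 => i /ltW h0; rewrite mulr_ge0.
  have q0 : 0 <= q by apply: sumr_ge0 => i h0; rewrite mulr_ge0 // oppr_ge0 ltW.
  have pq : p <= q.
    have := xs a; rewrite inE eqxx => /(_ isT); rewrite xE aE.
    rewrite (bigID (fun i => 0 < al i)) /= -/p [X in _ + X](bigID (fun i => al i < 0)) /=.
    rewrite [X in _ + (_ + X)]big1 ?addr0; last first.
      move=> i /andP[]; rewrite -!leNgt => h1 h2.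
      by rewrite -/(al i) (_ : al i = 0) ?mulr0 //; apply/eqP; rewrite eq_le h1.
    rewrite [X in _ + X](_ : _ = - q) ?subr_le0 //.
    rewrite /q -sumrN; apply: eq_big => [i|i _]; last by rewrite mulrN opprK.
    by rewrite -leNgt; case: (ltrP (al i) 0) => h1; rewrite ?(ltW h1) ?andbF.
  (* Weights [c i * c j / q] on the combinations reproduce [c i *: g i] for each violating [i] and
     use up the share [p / q] of each [c j] with [al j < 0]; the factor [1 - p / q] remains. *)
  exists (fun z => match z with
     | inl i => if al i < 0 then (1 - p / q) * c i else c i
     | inr e => c e.1 * c e.2 / q end).
    case=> [i|[i j]] /=; last by rewrite !mulr_ge0 ?invr_ge0.
    case: ifP => // _; rewrite mulr_ge0 // subr_ge0.
    have [->|qn] := eqVneq q 0; first by rewrite invr0 mulr0.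
    by rewrite ler_pdivrMr ?mul1r // lt_def qn.
  rewrite big_sumType /= -(pair_bigA _ (fun i j => (c i * c j / q) *:
    (if (0 < al i) && (al j < 0) then al i *: g j - al j *: g i else 0))) /=.
  have -> : \sum_i \sum_j (c i * c j / q) *:
      (if (0 < al i) && (al j < 0) then al i *: g j - al j *: g i else 0) =
      \sum_(j | al j < 0) (p / q * c j) *: g j + \sum_(i | 0 < al i) (q / q * c i) *: g i.
    transitivity (\sum_(i | 0 < al i) \sum_(j | al j < 0)
      ((c i * c j / q * al i) *: g j + (c i * c j / q * - al j) *: g i)).
      rewrite [RHS]big_mkcond; apply: eq_bigr => i _ /=; case: ifP => _ /=.
        rewrite [RHS]big_mkcond; apply: eq_bigr => j _ /=; case: ifP => _.
          by rewrite scalerBr !scalerA mulrN scaleNr.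
        by rewrite scaler0.
      by rewrite big1 // => j _; rewrite scaler0.
    under eq_bigr do rewrite big_split /=.
    rewrite big_split /= exchange_big /=; congr (_ + _); apply: eq_bigr => i _.
      rewrite -scaler_suml; congr (_ *: _).
      rewrite /p !mulr_suml; apply: eq_bigr => j _; ring.
    rewrite -scaler_suml; congr (_ *: _).
    rewrite /q -/q !mulr_suml; apply: eq_bigr => j _; ring.
  rewrite xE [LHS](bigID (fun i => 0 < al i)) /=.
  have -> : \sum_(i | 0 < al i) (q / q * c i) *: g i = \sum_(i | 0 < al i) c i *: g i.
    (* If [q = 0] then [q / q] is [0], but [p <= q] forces [p = 0], hence [c i = 0] for every
       violating [i]. *)
    apply: eq_bigr => i ai; have [qz|qn] := eqVneq q 0; last by rewrite divff ?mul1r.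
    have pz : p = 0 by apply/eqP; rewrite eq_le p0 -{1}qz pq.
    move/eqP: pz; rewrite psumr_eq0 => [|j /ltW aj]; last by rewrite mulr_ge0.
    move/allP => /(_ i); rewrite mem_index_enum ai => /(_ isT) /=.
    by rewrite mulf_eq0 (gt_eqF ai) orbF => /eqP ->; rewrite mulr0.
  rewrite addrA addrC; congr (_ + _).
  rewrite [LHS]big_mkcond [X in _ + X]big_mkcond -big_split; apply: eq_bigr => i _ /=.
  rewrite ltNge; case: (ltrgtP (al i) 0) => ai /=; rewrite ?scaler0 ?addr0 //.
  by rewrite -scalerDl; congr (_ *: _); ring.
have ah z : (a *m h z) 0 0 <= 0.
  case: z => [i|[i j]] /=.
    by case: ifP => // _; rewrite mulmx0 mxE.
  case: ifP => [/andP[ai aj]|_]; last by rewrite mulmx0 mxE.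
  by rewrite dE mulrC subrr.
move=> b; rewrite inE => /orP[/eqP ->|bs].
  by rewrite aE; apply: sumr_le0 => z _; rewrite mulr_ge0_le0.
have gb i : (b *m g i) 0 0 <= 0.
  apply: (IH (g i)).2 => //; exists (fun j => (j == i)%:R) => [j|]; first by case: eqP.
  rewrite (bigD1 i) //= eqxx scale1r big1 ?addr0 // => j /negbTE ->.
  by rewrite scale0r.
have hb z : (b *m h z) 0 0 <= 0.
  case: z => [i|[i j]] /=.
    by case: ifP => // _; rewrite mulmx0 mxE.
  case: ifP => [/andP[ai aj]|_]; last by rewrite mulmx0 mxE.
  rewrite dE; have := gb i; have := gb j; nra.
rewrite mulmx_sumr summxE; apply: sumr_le0 => z _.
by rewrite -scalemxAr mxE mulr_ge0_le0.
Qed.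

(** * Cluster points along nested nonempty sets *)

Lemma nested_mono (T : Type) (B : nat -> T -> Prop) :
  (forall n u, B n.+1 u -> B n u) -> forall m n u, (m <= n)%N -> B n u -> B m u.
Proof.
move=> nB m n u; elim: n => [|n IHn]; first by rewrite leqn0 => /eqP ->.
by rewrite leq_eqVlt => /orP[/eqP -> //|mn /nB]; apply: IHn.
Qed.

(** The cluster value is a limit superior: the supremum of the levels that [phi] reaches in every
    [B n]. *)
Lemma nested_cluster1 (R : realType) (T : Type) (B : nat -> T -> Prop) (phi : T -> R) :
  (forall n, exists u, B n u) -> (forall n u, B n.+1 u -> B n u) ->
  (forall n u, B n u -> 0 <= phi u <= 1) ->
  exists z, forall n (e : R), 0 < e -> exists2 u, B n u & `|phi u - z| <= e.
Proof.
move=> exB nB B01.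
pose E : set R := fun r => forall n, exists2 u, B n u & r <= phi u.
have E0 : E 0 by move=> n; have [u Bu] := exB n; exists u => //; case/andP: (B01 _ _ Bu).
have ubE : ubound E 1.
  move=> r /(_ 0%N) [u Bu ru]; apply: le_trans ru _.
  by case/andP: (B01 _ _ Bu).
have supE : has_sup E by split; [exists 0 | exists 1].
exists (sup E) => n e e0.
have [n0 Hn0] : exists n0, forall u, B n0 u -> phi u < sup E + e.
  apply: contrapT => /forallNP Hn.
  have : E (sup E + e).
    move=> m; have /existsNP[u /not_implyP[Bu /negP]] := Hn m.
    by rewrite -leNgt => h; exists u.
  by move/(sup_upper_bound supE); rewrite gerDl leNgt e0.
have [r Er rE] := sup_adherent e0 supE.
have [u Bu ru] := Er (maxn n n0).
exists u; first exact: nested_mono nB _ _ _ (leq_maxl _ _) Bu.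
have := Hn0 u (nested_mono nB (leq_maxr _ _) Bu).
by move=> h; rewrite ler_norml; apply/andP; split; lra.
Qed.

(** Bolzano-Weierstrass, one coordinate at a time. Shrinking [B n] to the points whose coordinate is
    within [1/(n+1)] of its cluster value keeps the sets nested and nonempty; this replaces passing
    to a subsequence. *)
Lemma nested_cluster (R : realType) (T : Type) (I : finType)
    (B : nat -> T -> Prop) (phi : T -> I -> R) :
  (forall n, exists u, B n u) -> (forall n u, B n.+1 u -> B n u) ->
  (forall n u, B n u -> forall i, 0 <= phi u i <= 1) ->
  exists z : I -> R, forall n (e : R), 0 < e ->
    exists2 u, B n u & forall i, `|phi u i - z i| <= e.
Proof.
move=> exB nB B01.
suff [z Hz] : exists z : I -> R, forall n (e : R), 0 < e ->
    exists2 u, B n u & forall i, i \in enum I -> `|phi u i - z i| <= e.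
  exists z => n e /(Hz n) [u Bu Hu]; exists u => // i; apply: Hu.
  by rewrite mem_enum.
elim: (enum I) B exB nB B01 => [|i s IHs] B exB nB B01.
  by exists (fun=> 0) => n e _; have [u Bu] := exB n; exists u.
have [zi Hzi] := nested_cluster1 exB nB (fun n u Bu => B01 n u Bu i).
pose B' n u := B n u /\ `|phi u i - zi| <= n.+1%:R^-1.
have nB' n u : B' n.+1 u -> B' n u.
  case=> /nB Bu h; split=> //; apply: le_trans h _.
  by rewrite lef_pV2 ?posrE ?ltr0n // ler_nat.
have [|z Hz] := IHs B' _ nB' (fun n u Bu => B01 n u Bu.1).
  by move=> n; have [|u] := Hzi n n.+1%:R^-1; [rewrite invr_gt0 ltr0n | exists u].
exists (fun j => if j == i then zi else z j) => n e e0.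
pose k := Num.bound e^-1.
have ke : k.+1%:R^-1 <= e.
  rewrite -[leRHS]invrK lef_pV2 ?posrE ?invr_gt0 ?ltr0n //.
  apply: le_trans (ltW (archi_boundP _)) _; first by rewrite invr_ge0 ltW.
  by rewrite ler_nat.
(* Level [n] places [u] in [B n]; level [k] brings its coordinate [i] within [e]. *)
have [u Bu Hu] := Hz (maxn n k) e e0; exists u.
  by case: (nested_mono nB' (leq_maxl _ _) Bu).
move=> j; rewrite inE; case: eqP => [-> _|_] /=; last exact: Hu.
by apply: le_trans (nested_mono nB' (leq_maxr _ _) Bu).2 ke.
Qed.

(** * Symmetric trilinear forms *)

(** The two transpositions generate all permutations of the arguments, so linearity in the first
    argument gives it in each. *)
Definition symmetric_trilinear (R : pzRingType) (V : lmodType R) (T : V -> V -> V -> R) :=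
  [/\ forall u v w, T u v w = T v u w, forall u v w, T u v w = T u w v
    & forall a u u' v w, T (a *: u + u') v w = a * T u v w + T u' v w].

Section Trilinear.
Variables (R : realFieldType) (V : lmodType R) (T : V -> V -> V -> R).
Hypothesis symT : symmetric_trilinear T.

Lemma tri12 u v w : T u v w = T v u w. Proof. by case: symT. Qed.
Lemma tri23 u v w : T u v w = T u w v. Proof. by case: symT. Qed.

Lemma triDl u u' v w : T (u + u') v w = T u v w + T u' v w.
Proof. by case: symT => _ _ /(_ 1 u u' v w); rewrite scale1r mul1r. Qed.

Lemma tri0l v w : T 0 v w = 0.
Proof. by have := triDl 0 0 v w; rewrite addr0 => /eqP; rewrite -subr_eq subrr => /eqP. Qed.

Lemma triZl a u v w : T (a *: u) v w = a * T u v w.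
Proof. by case: symT => _ _ /(_ a u 0 v w); rewrite tri0l !addr0. Qed.

Lemma triDm u v v' w : T u (v + v') w = T u v w + T u v' w.
Proof. by rewrite tri12 triDl ![T _ u w]tri12. Qed.

Lemma triZm a u v w : T u (a *: v) w = a * T u v w.
Proof. by rewrite tri12 triZl [T _ u w]tri12. Qed.

Lemma triDr u v w w' : T u v (w + w') = T u v w + T u v w'.
Proof. by rewrite tri23 triDm ![T u _ v]tri23. Qed.

Lemma triZr a u v w : T u v (a *: w) = a * T u v w.
Proof. by rewrite tri23 triZm [T u _ v]tri23. Qed.

Definition triE := (triDl, triDm, triDr, triZl, triZm, triZr).

Lemma tri_suml (I : finType) (F : I -> V) v w : T (\sum_i F i) v w = \sum_i T (F i) v w.
Proof. exact: (big_morph (fun u => T u v w) (fun x y => triDl x y v w) (tri0l v w)). Qed.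

Lemma tri_cubeD x y : T (x + y) (x + y) (x + y) =
  T x x x + 3 * T x x y + 3 * T x y y + T y y y.
Proof.
by rewrite !triE (tri12 y x) (tri23 x y x) (tri12 y x) (tri23 y y x) (tri12 y x y); ring.
Qed.

Lemma tri_cube_ray x y a : T (x + a *: y) (x + a *: y) (x + a *: y) =
  T x x x + 3 * T x x y * a + 3 * T x y y * a ^+ 2 + T y y y * a ^+ 3.
Proof. by rewrite tri_cubeD !triE; ring. Qed.

End Trilinear.

(** * Leading coefficients of polynomials bounded above *)

Lemma top_coef_le0 (R : realFieldType) (a C : R) :
  (forall x, 1 <= x -> a * x <= C) -> a <= 0.
Proof.
move=> H; rewrite leNgt; apply/negP => a0.
have C0 : 0 < C by have := H 1 (lexx _); lra.
have := H (1 + C / a); rewrite lerDl divr_ge0 ?(ltW C0) ?(ltW a0) // => /(_ isT).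
by rewrite mulrDr mulr1 mulrCA divff ?gt_eqF // mulr1 gerDr leNgt a0.
Qed.

(** For [x >= 1] the lower terms are absorbed in a constant times [x ^+ 2]; dividing by [x ^+ 2]
    leaves a linear function bounded above. *)
Lemma cubic_bounded_coef3 (R : realFieldType) (a b c d M : R) :
  (forall x, 0 <= x -> a + b * x + c * x ^+ 2 + d * x ^+ 3 <= M) -> d <= 0.
Proof.
move=> H; apply: (@top_coef_le0 _ _ (`|M - a| + `|b| + `|c|)) => x x1.
have x0 : 0 < x by lra.
have := H x (ltW x0).
have := ler_norm (M - a); have := ler_norm (- b); have := ler_norm (- c).
rewrite !normrN => h1 h2 h3 h4.
have [h5 h6 h7] : [/\ 0 <= `|M - a|, 0 <= `|b| & 0 <= `|c|] by split.
rewrite -(@ler_pM2r _ (x ^+ 2)) ?exprn_gt0 //.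
have h8 : 1 <= x ^+ 2 by rewrite exprn_ege1.
have h9 : x <= x ^+ 2 by rewrite expr2 ler_peMl // ltW.
have e1 : `|M - a| <= `|M - a| * x ^+ 2 by rewrite ler_peMr.
have e2 : `|b| * x <= `|b| * x ^+ 2 by rewrite ler_wpM2l.
have e3 : - c * x ^+ 2 <= `|c| * x ^+ 2 by rewrite ler_wpM2r // ltW // exprn_gt0.
have e4 : - b * x <= `|b| * x by rewrite ler_wpM2r // ltW.
rewrite !mulrDl -mulrA -exprS; lra.
Qed.

Lemma quadratic_bounded_coef2 (R : realFieldType) (a b c M : R) :
  (forall x, 0 <= x -> a + b * x + c * x ^+ 2 <= M) -> c <= 0.
Proof.
move=> H; apply: (@top_coef_le0 _ _ (`|M - a| + `|b|)) => x x1.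
have x0 : 0 < x by lra.
have := H x (ltW x0).
have := ler_norm (M - a); have := ler_norm (- b).
rewrite !normrN => h1 h2 h4.
rewrite -(@ler_pM2r _ x) //.
have e1 : `|M - a| <= `|M - a| * x by rewrite ler_peMr.
have e2 : - b * x <= `|b| * x by rewrite ler_wpM2r // ltW.
rewrite !mulrDl -mulrA -expr2; lra.
Qed.

Lemma affine_bounded_coef1 (R : realFieldType) (a b M : R) :
  (forall x, 0 <= x -> a + b * x <= M) -> b <= 0.
Proof.
move=> H; apply: (@top_coef_le0 _ _ (M - a)) => x x1.
by have := H x; lra.
Qed.

(** Passage to the limit [e -> 0]; the substitution [e = 1 / y] reduces it to [top_coef_le0]. *)
Lemma small_le0 (R : realFieldType) (x C : R) :
  (forall e, 0 < e <= 1 -> x <= C * e) -> x <= 0.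
Proof.
move=> H; apply: (@top_coef_le0 _ _ C) => y y1.
have y0 : 0 < y by lra.
rewrite -ler_pdivlMr //; apply: H.
by rewrite invr_gt0 y0 invf_le1.
Qed.

Lemma positive_minorant (R : realFieldType) (I : finType) (f : I -> R) :
  exists2 e : R, 0 < e <= 1 & forall i, 0 < f i -> e <= f i.
Proof.
exists (\big[Num.min/1]_(i | 0 < f i) f i); last by move=> i fi; apply: bigmin_le_cond.
rewrite bigmin_le_id andbT.
by elim/big_ind: _ => // x y x0 y0; rewrite lt_min x0.
Qed.

(** * The l1 norm and limit directions *)

Definition norm1 (R : numDomainType) (n : nat) (u : 'cV[R]_n) : R := \sum_i `|u i 0|.

Definition nonneg (R : numDomainType) (n : nat) (u : 'cV[R]_n) := forall i, 0 <= u i 0.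

Section Norm1.
Variables (R : realFieldType) (n : nat).
Implicit Types u v w : 'cV[R]_n.

Lemma norm1_ge0 u : 0 <= norm1 u.
Proof. exact: sumr_ge0. Qed.

Lemma norm1_ge_coord u i : `|u i 0| <= norm1 u.
Proof. by rewrite /norm1 (bigD1 i) //= lerDl sumr_ge0. Qed.

Lemma norm1D u v : norm1 (u + v) <= norm1 u + norm1 v.
Proof. by rewrite -big_split; apply: ler_sum => i _; rewrite mxE ler_normD. Qed.

Lemma norm1Z a u : norm1 (a *: u) = `|a| * norm1 u.
Proof. by rewrite /norm1 mulr_sumr; apply: eq_bigr => i _; rewrite mxE normrM. Qed.

Lemma norm1N u : norm1 (- u) = norm1 u.
Proof. by rewrite -scaleN1r norm1Z normrN1 mul1r. Qed.

Lemma norm1_delta i : norm1 (delta_mx i 0 : 'cV[R]_n) = 1.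
Proof.
rewrite /norm1 (bigD1 i) //= mxE !eqxx normr1 big1 ?addr0 // => j /negbTE ji.
by rewrite mxE ji normr0.
Qed.

Lemma norm1_nonneg u : nonneg u -> norm1 u = \sum_i u i 0.
Proof. by move=> u0; apply: eq_bigr => i _; rewrite ger0_norm. Qed.

Lemma cV_sum_delta u : u = \sum_i u i 0 *: delta_mx i 0.
Proof.
by rewrite {1}[u]matrix_sum_delta; apply: eq_bigr => i _; rewrite big_ord1.
Qed.

Variable T : 'cV[R]_n -> 'cV[R]_n -> 'cV[R]_n -> R.
Hypothesis symT : symmetric_trilinear T.

Lemma tri_coordl u v w : T u v w = \sum_i u i 0 * T (delta_mx i 0) v w.
Proof.
rewrite {1}[u]cV_sum_delta (tri_suml symT).
by apply: eq_bigr => i _; rewrite (triZl symT).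
Qed.

Lemma tri_norm1 : exists2 B, 0 <= B &
  forall u v w, `|T u v w| <= B * norm1 u * norm1 v * norm1 w.
Proof.
pose t i j k := T (delta_mx i 0) (delta_mx j 0) (delta_mx k 0).
exists (\sum_i \sum_j \sum_k `|t i j k|).
  by do 3!(apply: sumr_ge0 => ? _).
move=> u v w.
have -> : T u v w = \sum_i \sum_j \sum_k u i 0 * v j 0 * w k 0 * t i j k.
  rewrite tri_coordl; apply: eq_bigr => i _.
  rewrite (tri12 symT) tri_coordl mulr_sumr; apply: eq_bigr => j _.
  rewrite (tri12 symT) (tri23 symT) (tri12 symT) tri_coordl !mulr_sumr; apply: eq_bigr => k _.
  by rewrite (tri12 symT) (tri23 symT) !mulrA.
rewrite !mulr_suml; apply: le_trans (ler_norm_sum _ _ _) _; apply: ler_sum => i _.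
rewrite !mulr_suml; apply: le_trans (ler_norm_sum _ _ _) _; apply: ler_sum => j _.
rewrite !mulr_suml; apply: le_trans (ler_norm_sum _ _ _) _; apply: ler_sum => k _.
rewrite !normrM mulrC -!mulrA ler_wpM2l //.
rewrite !mulrA !ler_pM ?mulr_ge0 ?norm1_ge_coord //.
Qed.

End Norm1.

(** The points [c / norm1 c] have coordinates in [[0, 1]], hence a cluster point [d]. *)
Lemma direction_cluster (R : realType) (n : nat) (B : nat -> 'cV[R]_n -> Prop) :
  (forall k, exists c, B k c) -> (forall k c, B k.+1 c -> B k c) ->
  (forall k c, B k c -> nonneg c /\ 0 < norm1 c) ->
  exists d : 'cV[R]_n, [/\ nonneg d, norm1 d = 1 &
    forall k e, 0 < e -> exists2 c, B k c & norm1 (c - norm1 c *: d) <= e * norm1 c].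
Proof.
move=> exB nB B0.
have [|z Hz] := nested_cluster exB nB (phi := fun (c : 'cV[R]_n) i => c i 0 / norm1 c).
  move=> k c /B0 [c0 n0] i; rewrite divr_ge0 ?(ltW n0) //=.
  by rewrite ler_pdivrMr // mul1r -[leLHS]ger0_norm // norm1_ge_coord.
pose d : 'cV[R]_n := \col_i z i.
have Hd k e : 0 < e -> exists2 c, B k c & norm1 (c - norm1 c *: d) <= e * norm1 c.
  (* Each of the [n] coordinates is allowed the error [e / (n+1)]; the extra one avoids division by
     zero when [n = 0]. *)
  move=> e0; have [|c Bc Hc] := Hz k (e / n.+1%:R); first by rewrite divr_gt0 ?ltr0n.
  exists c => //; have [c0 n0] := B0 _ _ Bc.
  have -> : e * norm1 c = \sum_(i < n.+1) e / n.+1%:R * norm1 c.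
    by rewrite sumr_const card_ord -[RHS]mulr_natr mulrAC divfK ?pnatr_eq0.
  rewrite big_ord_recr /= -[leLHS]addr0; apply: lerD; last first.
    by rewrite !mulr_ge0 ?invr_ge0 ?ler0n ?(ltW e0) ?(ltW n0).
  apply: ler_sum => i _; rewrite !mxE.
  rewrite (_ : c i 0 - _ = (c i 0 / norm1 c - z i) * norm1 c).
    by rewrite normrM [X in _ * X]gtr0_norm // ler_wpM2r ?(ltW n0).
  by field; rewrite gt_eqF.
exists d; split=> //.
  move=> i; rewrite mxE -oppr_le0; apply: (@small_le0 _ _ 1) => e /andP[e0 _].
  have [c Bc /(_ i)] := Hz 0%N e e0; have [c0 n0] := B0 _ _ Bc.
  have : 0 <= c i 0 / norm1 c by rewrite divr_ge0 ?(ltW n0).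
  by rewrite ler_norml mul1r => ? /andP[? ?]; lra.
have key e : 0 < e -> `|1 - norm1 d| <= e.
  move=> e0; have [c Bc Hc] := Hd 0%N e e0; have [c0 n0] := B0 _ _ Bc.
  rewrite -(ler_pM2r n0); apply: le_trans Hc.
  have -> : `|1 - norm1 d| * norm1 c = `|norm1 c - norm1 (norm1 c *: d)|.
    by rewrite norm1Z (gtr0_norm n0) -{1}(gtr0_norm n0) -normrM; congr `|_|; ring.
  have h1 : norm1 c <= norm1 (c - norm1 c *: d) + norm1 (norm1 c *: d).
    by rewrite -{1}[c](subrK (norm1 c *: d)) norm1D.
  have h2 : norm1 (norm1 c *: d) <= norm1 (c - norm1 c *: d) + norm1 c.
    by rewrite -[X in X + _]norm1N opprB -{1}[_ *: d](subrK c) norm1D.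
  by rewrite ler_norml; lra.
apply/eqP; rewrite eq_sym -subr_eq0 -normr_le0.
by apply: (@small_le0 _ _ 1) => e /andP[e0 _]; rewrite mul1r key.
Qed.

(** * Recession directions on which the cubic form vanishes *)

Section RecessionForm.
Variables (R : realFieldType) (n : nat) (T : 'cV[R]_n -> 'cV[R]_n -> 'cV[R]_n -> R).
Variable tau : 'rV[R]_n.
Hypotheses (symT : symmetric_trilinear T) (tau_ge0 : forall i, 0 <= tau 0 i).
Hypothesis ray_bounded : forall c d, nonneg c -> (tau *m c) 0 0 = 1 ->
  nonneg d -> (tau *m d) 0 0 = 0 ->
  exists M, forall x, 0 <= x -> T (c + x *: d) (c + x *: d) (c + x *: d) <= M.
Variable c0 : 'cV[R]_n.
Hypotheses (c0_ge0 : nonneg c0) (tau_c0 : (tau *m c0) 0 0 = 1).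

Lemma nonnegD (u v : 'cV[R]_n) : nonneg u -> nonneg v -> nonneg (u + v).
Proof. by move=> u0 v0 i; rewrite mxE addr_ge0. Qed.

Lemma nonnegZ (a : R) (u : 'cV[R]_n) : 0 <= a -> nonneg u -> nonneg (a *: u).
Proof. by move=> a0 u0 i; rewrite mxE mulr_ge0. Qed.

Lemma tauD (u v : 'cV[R]_n) : (tau *m (u + v)) 0 0 = (tau *m u) 0 0 + (tau *m v) 0 0.
Proof. by rewrite mulmxDr mxE. Qed.

Lemma tauZ (a : R) (u : 'cV[R]_n) : (tau *m (a *: u)) 0 0 = a * (tau *m u) 0 0.
Proof. by rewrite -scalemxAr mxE. Qed.

Lemma tau_nonneg u : nonneg u -> 0 <= (tau *m u) 0 0.
Proof. by move=> u0; rewrite mxE sumr_ge0 // => i _; rewrite mulr_ge0. Qed.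

Lemma recession_cube_le0 d : nonneg d -> (tau *m d) 0 0 = 0 -> T d d d <= 0.
Proof.
move=> d0 td; have [M HM] := ray_bounded c0_ge0 tau_c0 d0 td.
apply: (@cubic_bounded_coef3 _ (T c0 c0 c0) (3 * T c0 c0 d) (3 * T c0 d d) _ M) => x x0.
by rewrite -tri_cube_ray // HM.
Qed.

Variable d : 'cV[R]_n.
Hypotheses (d_ge0 : nonneg d) (tau_d : (tau *m d) 0 0 = 0) (Tddd : T d d d = 0).

Lemma recession_quadratic_le0_affine c : nonneg c -> (tau *m c) 0 0 = 1 -> T c d d <= 0.
Proof.
move=> c_ge0 tc; have [M HM] := ray_bounded c_ge0 tc d_ge0 tau_d.
suff : 3 * T c d d <= 0 by lra.
apply: (@quadratic_bounded_coef2 _ (T c c c) (3 * T c c d) _ M) => x x0.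
by have := HM x x0; rewrite tri_cube_ray // Tddd mul0r addr0.
Qed.

(** If [tau y > 0], then [y] can be rescaled into the slice. If [tau y = 0], the ray [c0 + x y]
    stays in the slice, and [T (c0 + x y) d d], affine in [x] and at most [0], has slope at most
    [0]. *)
Lemma recession_quadratic_le0 y : nonneg y -> T y d d <= 0.
Proof.
move=> y0; have [ty|ty] := eqVneq ((tau *m y) 0 0) 0.
  apply: (@affine_bounded_coef1 _ (T c0 d d) _ 0) => x x0.
  rewrite mulrC -(triZl symT) -(triDl symT); apply: recession_quadratic_le0_affine.
    by apply: nonnegD => //; apply: nonnegZ.
  by rewrite tauD tauZ ty mulr0 addr0.
have tp : 0 < (tau *m y) 0 0 by rewrite lt_def ty tau_nonneg.
have := @recession_quadratic_le0_affine (((tau *m y) 0 0)^-1 *: y).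
rewrite tauZ mulVf // (triZl symT) => /(_ _ erefl) H.
rewrite -(pmulr_rle0 _ (_ : 0 < ((tau *m y) 0 0)^-1)) ?invr_gt0 //; apply: H.
by apply: nonnegZ; rewrite ?invr_ge0 ?(ltW tp).
Qed.

(** If [tau y = 0], then [d + e y] is again a recession direction, with cube
    [3 e^2 T y y d + e^3 T y y y <= 0]; divide by [e^2] and let [e -> 0]. If [tau y > 0], the form
    is affine along the ray from the rescaled [y] in direction [d], with slope a positive multiple
    of [T y y d]. *)
Lemma recession_linear_le0 y : nonneg y -> T y d d = 0 -> T y y d <= 0.
Proof.
move=> y0 Ty; have [ty|ty] := eqVneq ((tau *m y) 0 0) 0.
  suff : 3 * T y y d <= 0 by lra.
  apply: (@small_le0 _ _ (- T y y y)) => e /andP[e0 _].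
  have : T (d + e *: y) (d + e *: y) (d + e *: y) <= 0.
    apply: recession_cube_le0; last by rewrite tauD tauZ ty tau_d mulr0 addr0.
    by apply: nonnegD => //; apply: nonnegZ => //; apply: ltW.
  rewrite tri_cube_ray // Tddd (tri23 symT) (tri12 symT) Ty.
  rewrite (tri12 symT d) (tri23 symT y d) => H.
  by rewrite -(ler_pM2r (exprn_gt0 2 e0)); lra.
have tp : 0 < (tau *m y) 0 0 by rewrite lt_def ty tau_nonneg.
pose a := ((tau *m y) 0 0)^-1.
have a0 : 0 < a by rewrite invr_gt0.
have [||M HM] := @ray_bounded (a *: y) d _ _ d_ge0 tau_d.
- by apply: nonnegZ => //; apply: ltW.
- by rewrite tauZ mulVf.
suff : 3 * (a * (a * T y y d)) <= 0 by rewrite !pmulr_rle0.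
apply: (@affine_bounded_coef1 _ (T (a *: y) (a *: y) (a *: y)) _ M) => x x0.
have := HM x x0; rewrite tri_cube_ray // Tddd !(triE symT) Ty; lra.
Qed.

(** With [F c = T c c c] and [T d d d = 0], [F (c - d) - F c = 3 (T c d d - T c c d)]. Since
    [T c d d <= 0] and [norm1 c >= 1], it is enough that [T c c d <= norm1 c * T c d d]. *)
Lemma recession_step : norm1 d = 1 ->
  exists2 e : R, 0 < e & forall c, nonneg c -> 2 <= norm1 c ->
    norm1 (c - norm1 c *: d) <= e * norm1 c ->
    nonneg (c - d) /\ T c c c <= T (c - d) (c - d) (c - d).
Proof.
move=> nd; have [b b0 Hb] := tri_norm1 symT.
pose l i := T (delta_mx i 0) d d.
have l0 i : l i <= 0.
  by apply: recession_quadratic_le0 => j; rewrite mxE; case: andP.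
(* The terms [d i * l i] are all at most [0] and sum to [T d d d = 0], so each vanishes. *)
have dl i : l i < 0 -> d i 0 = 0.
  move=> li; have : \sum_i d i 0 * - l i = 0.
    by under eq_bigr do rewrite mulrN; rewrite sumrN -(tri_coordl symT) Tddd oppr0.
  move/eqP; rewrite psumr_eq0 => [|j _]; last by rewrite mulr_ge0 ?oppr_ge0.
  move/allP => /(_ i); rewrite mem_index_enum => /(_ isT) /=.
  by rewrite mulf_eq0 oppr_eq0 (lt_eqF li) orbF => /eqP.
(* [e1] makes the error [3 b e1 norm1 c] arising in [rch] at most [- l i * norm1 c]; the added [1]
   keeps the denominator positive. *)
have [e1 /andP[e10 _] He1] := positive_minorant (fun i => - l i / (3 * b + 1)).
(* As [norm1 c >= 2], an error of [d i / 2 * norm1 c] still leaves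
   [c i >= d i / 2 * norm1 c >= d i]. *)
have [e2 /andP[e20 _] He2] := positive_minorant (fun i => d i 0 / 2).
exists (Num.min e1 e2); first by rewrite lt_min e10.
move=> c c_ge0 c2 Hc; set w := c - norm1 c *: d in Hc.
have nc : 0 < norm1 c by lra.
have Hw1 : norm1 w <= e1 * norm1 c.
  by apply: le_trans Hc _; rewrite ler_wpM2r ?(ltW nc) // ge_min lexx.
have Hw2 : norm1 w <= e2 * norm1 c.
  by apply: le_trans Hc _; rewrite ler_wpM2r ?(ltW nc) // ge_min lexx orbT.
have cdd := recession_quadratic_le0 c_ge0.
split.
  move=> i; rewrite !mxE subr_ge0.
  have [di|di] := eqVneq (d i 0) 0; first by rewrite di.
  have dp : 0 < d i 0 by rewrite lt_def di d_ge0.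
  have /He2 e2d : 0 < d i 0 / 2 by rewrite divr_gt0.
  have : `|w i 0| <= d i 0 / 2 * norm1 c.
    apply: le_trans (norm1_ge_coord _ _) _; apply: le_trans Hw2 _.
    by rewrite ler_wpM2r ?(ltW nc).
  have : d i 0 / 2 * 2 <= d i 0 / 2 * norm1 c by rewrite ler_wpM2l // divr_ge0.
  by rewrite ler_norml !mxE => ? /andP[? ?]; lra.
(* [d i 0 = 0] wherever [l i < 0], so [r = c - h] is dominated by the small vector [w]. *)
pose h : 'cV[R]_n := \col_i (if l i == 0 then c i 0 else 0).
pose r := c - h.
have cE : c = h + r by rewrite /r addrC subrK.
have h0 : nonneg h by move=> i; rewrite mxE; case: ifP.
have hl i : h i 0 * l i = 0 by rewrite mxE; case: eqP => [->|]; rewrite ?mulr0 ?mul0r.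
(* [h] is supported where [l i = 0], so the part [T h h d] of [T c c d] is at most [0]. *)
have hdd : T h d d = 0 by rewrite (tri_coordl symT) big1.
have hhd := recession_linear_le0 h0 hdd.
have rE i : r i 0 = if l i == 0 then 0 else c i 0.
  by rewrite !mxE; case: ifP; rewrite ?subrr ?subr0.
have nr : norm1 r <= norm1 w.
  apply: ler_sum => i _; rewrite rE; case: eqP => [_|/eqP li]; first by rewrite normr0.
  by rewrite !mxE dl ?mulr0 ?subr0 // lt_def eq_sym li /=.
(* Since [c + h = 2 norm1 c d + (2 w - r)], the value [T e_i (c + h) d] exceeds [2 norm1 c * l i] by
   at most [- l i * norm1 c]: half of the main term survives. *)
have rch : T r (c + h) d <= norm1 c * T c d d.
  rewrite (tri_coordl symT) [T c d d](tri_coordl symT) mulr_sumr.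
  apply: ler_sum => i _; have -> : c i 0 * l i = r i 0 * l i.
    by rewrite rE; case: eqP => // ->; rewrite !mulr0.
  rewrite rE; case: eqP => [_|/eqP li]; first by rewrite !mul0r mulr0.
  have lip : 0 < - l i by rewrite oppr_gt0 lt_def eq_sym li /=.
  rewrite mulrCA ler_wpM2l //.
  have -> : c + h = (2 * norm1 c) *: d + (2 *: w - r).
    by apply/matrixP => a j; rewrite !mxE; ring.
  rewrite (triDm symT) (triZm symT) -/(l i).
  have h1 : norm1 (2 *: w - r) <= 3 * norm1 w.
    apply: le_trans (norm1D _ _) _; rewrite norm1N norm1Z ger0_norm //; lra.
  have := Hb (delta_mx i 0) (2 *: w - r) d; rewrite norm1_delta nd !mulr1 => h2.
  have /He1 h3 : 0 < - l i / (3 * b + 1) by rewrite divr_gt0 // ltr_wpDl ?mulr_ge0.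
  rewrite ler_pdivlMr in h3; last by rewrite ltr_wpDl ?mulr_ge0.
  have h4 : T (delta_mx i 0) (2 *: w - r) d <= b * (3 * (e1 * norm1 c)).
    apply: le_trans (ler_norm _) _; apply: le_trans h2 _; rewrite ler_wpM2l //.
    by apply: le_trans h1 _; rewrite ler_wpM2l.
  have h5 : e1 * (3 * b + 1) * norm1 c <= - l i * norm1 c by rewrite ler_wpM2r ?(ltW nc).
  have h6 : 0 < e1 * norm1 c by rewrite mulr_gt0.
  lra.
have ccd : T c c d <= norm1 c * T c d d.
  have TD x y : T (x + y) (x + y) d = T x x d + T y (x + y + x) d.
    by rewrite !(triE symT) (tri12 symT x y); ring.
  by rewrite {1 2}cE TD -cE; lra.
rewrite -scaleN1r tri_cube_ray // Tddd.
have : (norm1 c - 1) * T c d d <= 0 by rewrite mulr_ge0_le0 // subr_ge0; lra.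
lra.
Qed.

End RecessionForm.

(** * Boundedness on the slice *)

(** Either some [B k] is empty, and improving moves bring every point into a fixed ball without
    lowering the form; or the [B k] have a limit direction [d], and [recession_step] contradicts the
    choice of [B]. *)
Lemma cubic_form_bounded (R : realType) (n : nat)
    (T : 'cV[R]_n -> 'cV[R]_n -> 'cV[R]_n -> R) (tau : 'rV[R]_n) :
  symmetric_trilinear T -> (forall i, 0 <= tau 0 i) ->
  (forall c d, nonneg c -> (tau *m c) 0 0 = 1 ->
    nonneg d -> (tau *m d) 0 0 = 0 ->
    exists M, forall x, 0 <= x -> T (c + x *: d) (c + x *: d) (c + x *: d) <= M) ->
  exists M, forall c, nonneg c -> (tau *m c) 0 0 = 1 -> T c c c <= M.
Proof.
move=> symT tau0 rayb; have [b b0 Hb] := tri_norm1 symT.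
(* [B k c]: [c] is far away and no point of the slice closer by 1 is at least as good. *)
pose B (k : nat) (c : 'cV[R]_n) := [/\ nonneg c, (tau *m c) 0 0 = 1, k.+2%:R <= norm1 c
  & forall c', nonneg c' -> (tau *m c') 0 0 = 1 -> T c c c <= T c' c' c' ->
    norm1 c - 1 < norm1 c'].
have [exB|] := pselect (forall k, exists c, B k c); last first.
  move/existsNP => [k /forallNP nB]; exists (b * k.+2%:R * k.+2%:R * k.+2%:R).
  (* Induction on the number of unit steps separating [c] from the ball of radius [k + 2]. *)
  suff H (m : nat) c : norm1 c <= k.+2%:R + m%:R -> nonneg c -> (tau *m c) 0 0 = 1 ->
      T c c c <= b * k.+2%:R * k.+2%:R * k.+2%:R.
    move=> c; apply: (H (Num.bound (norm1 c))).
    by apply: ler_wpDl; rewrite // ltW // archi_boundP // norm1_ge0.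
  elim: m c => [|m IHm] c Hc c_ge0 tc.
    rewrite addr0 in Hc; apply: le_trans (ler_norm _) (le_trans (Hb _ _ _) _).
    by rewrite !ler_pM ?mulr_ge0 ?norm1_ge0.
  have [ck|kc] := lerP (norm1 c) (k.+2%:R + m%:R); first exact: IHm.
  have [c' [c'_ge0 tc' Fc nc']] : exists c', [/\ nonneg c', (tau *m c') 0 0 = 1,
      T c c c <= T c' c' c' & norm1 c' <= norm1 c - 1].
    apply: contrapT => /forallNP H; apply: (nB c); split=> //.
      by apply: le_trans (ltW kc); rewrite lerDl.
    move=> c' c'0 tc' Fc; rewrite ltNge; apply/negP => nc'.
    by apply: (H c').
  apply: le_trans Fc (IHm _ _ c'_ge0 tc').
  by move: Hc; rewrite -(natr1 m); lra.
exfalso.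
have nB k c : B k.+1 c -> B k c.
  by case=> ? ? kc ?; split=> //; apply: le_trans kc; rewrite ler_nat.
have B0 k c : B k c -> nonneg c /\ 0 < norm1 c.
  by case=> ? ? kc _; split=> //; apply: lt_le_trans kc; rewrite ltr0n.
have [d [d0 nd Hd]] := direction_cluster exB nB B0.
have [c0 [c0_ge0 tc0 _ _]] := exB 0%N.
have Hfar e : 0 < e -> exists c, [/\ nonneg c, (tau *m c) 0 0 = 1,
    norm1 (c - norm1 c *: d) <= e * norm1 c, 1 <= e * norm1 c & T c0 c0 c0 < T c c c].
  (* The first summand gives [1 <= e * norm1 c]. The second puts [c0] closer than [c] by at least 1,
     so by [B] it is strictly worse; this bounds the form below at the far points. *)
  move=> e0; pose k := (Num.bound e^-1 + Num.bound (norm1 c0))%N.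
  have [c [c_ge0 tc kc Hc] Hcd] := Hd k e e0; exists c; split=> //.
    rewrite -ler_pdivrMl // mulr1; apply: le_trans kc.
    apply: le_trans (ltW (archi_boundP _)) _; first by rewrite invr_ge0 ltW.
    by rewrite ler_nat 2?leqW // leq_addr.
  rewrite ltNge; apply/negP => /(Hc _ c0_ge0 tc0).
  apply/negP; rewrite -leNgt lerBrDr; apply: le_trans kc.
  rewrite -(natr1 k.+1) lerD2r; apply: le_trans (ltW (archi_boundP (norm1_ge0 _))) _.
  by rewrite ler_nat leqW // leq_addl.
(* [tau d] is close to [tau c / norm1 c = 1 / norm1 c], which is at most [e]. *)
have td : (tau *m d) 0 0 = 0.
  apply/eqP; rewrite -normr_le0.
  pose W := \sum_i `|tau 0 i|.
  have HW w : `|(tau *m w) 0 0| <= W * norm1 w.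
    rewrite mxE; apply: le_trans (ler_norm_sum _ _ _) _.
    rewrite mulr_suml; apply: ler_sum => i _; rewrite normrM ler_wpM2l //.
    exact: norm1_ge_coord.
  apply: (@small_le0 _ _ (1 + W)) => e /andP[e0 _].
  have [c [c_ge0 tc Hcd ec _]] := Hfar e e0.
  have nc : 0 < norm1 c by rewrite -(pmulr_rgt0 _ e0); lra.
  have := HW (c - norm1 c *: d); rewrite -scaleNr tauD tauZ tc => h1.
  have h2 : W * norm1 (c + - norm1 c *: d) <= W * (e * norm1 c).
    by rewrite ler_wpM2l ?sumr_ge0 // scaleNr.
  rewrite -(ler_pM2r nc) -{1}(gtr0_norm nc) -normrM.
  move: h1; rewrite !ler_norml => /andP[? ?]; lra.
have Tddd : T d d d = 0.
  apply/eqP; rewrite eq_le; apply/andP; split.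
    exact: recession_cube_le0 symT rayb _ c0_ge0 tc0 _ d0 td.
  (* For [c = s (d + v)] with [norm1 v <= e <= 1], the form is at most [s^3 (T d d d + 7 b e)],
     where [7 = 3 + 3 + 1], and at least [- |T c0 c0 c0| e s^3] because [e s^3 >= 1]. *)
  rewrite -oppr_le0; apply: (@small_le0 _ _ (7 * b + `|T c0 c0 c0|)) => e /andP[e0 e1].
  have [c [c_ge0 tc Hcd ec Fc]] := Hfar e e0.
  have nc : 0 < norm1 c by rewrite -(pmulr_rgt0 _ e0); lra.
  set s := norm1 c in nc ec Hcd *.
  have [v cE nv] : exists2 v, c = s *: (d + v) & norm1 v <= e.
    exists (s^-1 *: (c - s *: d)).
      by rewrite scalerDr scalerA divff ?gt_eqF // scale1r addrC subrK.
    by rewrite norm1Z ger0_norm ?invr_ge0 ?(ltW nc) // ler_pdivrMl // mulrC.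
  have v0 := norm1_ge0 v.
  have TE : T c c c = s ^+ 3 * (T d d d + 3 * T d d v + 3 * T d v v + T v v v).
    by rewrite -(tri_cubeD symT) cE !(triZl symT, triZm symT, triZr symT); ring.
  have v2 : norm1 v * norm1 v <= e by rewrite -[e]mulr1 ler_pM //; lra.
  have v3 : norm1 v * norm1 v * norm1 v <= e by rewrite -[e]mulr1 ler_pM ?mulr_ge0 //; lra.
  have Hv x y z : norm1 x * norm1 y * norm1 z <= e -> T x y z <= b * e.
    move=> h; apply: le_trans (ler_norm _) (le_trans (Hb _ _ _) _).
    by rewrite -!mulrA ler_wpM2l // mulrA.
  have h1 : T d d v <= b * e by apply: Hv; rewrite nd !mul1r.
  have h2 : T d v v <= b * e by apply: Hv; rewrite nd !mul1r.
  have h3 : T v v v <= b * e by apply: Hv.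
  have s1 : 1 <= s by apply: le_trans ec _; rewrite ler_piMl ?(ltW nc).
  have s3 : 1 <= e * s ^+ 3.
    apply: le_trans ec _; rewrite ler_wpM2l ?(ltW e0) // exprS ler_peMr ?(ltW nc) //.
    by rewrite exprn_ege1.
  have h4 : - `|T c0 c0 c0| * (e * s ^+ 3) <= T c c c.
    apply: le_trans (ltW Fc); apply: le_trans (_ : - `|T c0 c0 c0| <= _).
      by rewrite mulNr lerN2 ler_peMr.
    by rewrite lerNl -normrN ler_norm.
  rewrite -(ler_pM2r (exprn_gt0 3 nc)).
  have h5 : s ^+ 3 * (T d d d + 3 * T d d v + 3 * T d v v + T v v v) <=
      s ^+ 3 * (T d d d + 7 * (b * e)).
    by rewrite ler_wpM2l ?exprn_ge0 ?(ltW nc) //; lra.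
  rewrite TE in h4; lra.
have [e e0 He] := recession_step symT tau0 rayb c0_ge0 tc0 d0 td Tddd nd.
(* Level [0] of [B] already contains the bound [2 <= norm1 c] that the step requires. *)
have [c [c_ge0 tc kc Hc] Hcd] := Hd 0%N e e0.
have [cd_ge0 Fcd] := He c c_ge0 kc Hcd.
have := Hc _ cd_ge0 _ Fcd; rewrite -scaleN1r tauD tauZ td mulr0 addr0 tc => /(_ erefl).
(* On nonnegative vectors the norm is additive, so [norm1 (c - d)] is exactly [norm1 c - 1], against
   the strict inequality in [B]. *)
rewrite scaleN1r !norm1_nonneg //.
under [X in _ < X]eq_bigr do rewrite !mxE.
by rewrite sumrB -(norm1_nonneg d0) nd ltxx.
Qed.

(** * Polynomials of degree at most three as cubic forms *)

Definition homogenize (R : pzRingType) (n : nat) (x : 'cV[R]_n) : 'cV[R]_(n + 1) :=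
  col_mx x 1%:M.

(** Variables are peeled off one at a time; the factors missing up to [d] are copies of the last
    coordinate, which is 1. *)
Lemma monomial_homogenize (R : realType) (n d : nat) (m : 'X_{1..n}) : (mdeg m <= d)%N ->
  exists2 s : seq 'I_(n + 1), size s = d &
    forall x : 'cV[R]_n, \prod_i x i 0 ^+ m i = \prod_(a <- s) homogenize x a 0.
Proof.
elim: d m => [|d IHd] m.
  rewrite leqn0 mdeg_eq0 => /eqP ->; exists [::] => // x.
  by rewrite big_nil big1 // => i _; rewrite mnm0E.
have [i mi|m0] := pickP (fun i => m i != 0%N); last first.
  exists (nseq d.+1 (rshift n ord0)); first by rewrite size_nseq.
  move=> x; rewrite big1 => [|i _]; last by rewrite (eqP (negbFE (m0 i))).
  rewrite big1_seq // => a /andP[_]; rewrite mem_nseq => /andP[_ /eqP ->].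
  by rewrite /homogenize col_mxEd mxE.
rewrite -lep1mP in mi; rewrite -(submK mi) mdegD mdeg1 addn1 ltnS => /IHd[s <- Hs].
exists (lshift 1 i :: s) => // x; rewrite big_cons -Hs /homogenize col_mxEu.
rewrite (bigD1 i) //= [in RHS](bigD1 i) //= mnmDE mnm1E eqxx addn1 exprS -mulrA.
congr (_ * (_ * _)); apply: eq_bigr => j ji.
by rewrite mnmDE mnm1E eq_sym (negbTE ji) addn0.
Qed.

Section SymmetricProduct.
Variables (R : realFieldType) (k : nat).

(** The polarization of the monomial [u_a u_b u_c]: the average over the six permutations. *)
Definition sym_prod (a b c : 'I_k) (u v w : 'cV[R]_k) : R :=
  6^-1 * (u a 0 * v b 0 * w c 0 + u a 0 * v c 0 * w b 0 + u b 0 * v a 0 * w c 0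
        + u b 0 * v c 0 * w a 0 + u c 0 * v a 0 * w b 0 + u c 0 * v b 0 * w a 0).

Lemma sym_prod_trilinear a b c : symmetric_trilinear (sym_prod a b c).
Proof. by split=> *; rewrite /sym_prod ?mxE; ring. Qed.

Lemma sym_prod_diag a b c u : sym_prod a b c u u u = u a 0 * u b 0 * u c 0.
Proof. by rewrite /sym_prod; field. Qed.

End SymmetricProduct.

Lemma symmetric_trilinear_sum (R : comPzRingType) (V : lmodType R) (I : Type) (s : seq I)
    (p : I -> R) (T : I -> V -> V -> V -> R) :
  (forall i, symmetric_trilinear (T i)) ->
  symmetric_trilinear (fun u v w => \sum_(i <- s) p i * T i u v w).
Proof.
move=> symT; split=> [u v w|u v w|a u u' v w].
- by apply: eq_bigr => i _; case: (symT i) => ->.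
- by apply: eq_bigr => i _; case: (symT i) => _ ->.
- rewrite mulr_sumr -big_split; apply: eq_bigr => i _ /=.
  by case: (symT i) => _ _ ->; ring.
Qed.

Lemma symmetric_trilinear_comp (R : comPzRingType) (V W : lmodType R)
    (g : {linear W -> V}) (T : V -> V -> V -> R) :
  symmetric_trilinear T -> symmetric_trilinear (fun u v w => T (g u) (g v) (g w)).
Proof. by case=> T1 T2 T3; split=> *; rewrite ?linearP. Qed.

Lemma finitely_generated_cone_mx (R : realFieldType) (k : nat) (s : seq 'rV[R]_k) :
  exists (N : nat) (G : 'M[R]_(k, N)), forall x : 'cV[R]_k,
    (forall a, a \in s -> (a *m x) 0 0 <= 0) <-> (exists2 c, nonneg c & x = G *m c).
Proof.
have [I [g Hg]] := finitely_generated_cone s.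
exists #|I|, (\matrix_(a, j) g (enum_val j) a 0) => x.
have GE (c : 'cV[R]_#|I|) : (\matrix_(a, j) g (enum_val j) a 0) *m c =
    \sum_i c (enum_rank i) 0 *: g i.
  rewrite [RHS](reindex _ (onW_bij _ (@enum_val_bij I))) /=.
  apply/matrixP => a j; rewrite ord1 mxE summxE; apply: eq_bigr => l _.
  by rewrite !mxE enum_valK mulrC.
rewrite Hg; split=> [[c c0 ->]|[c c0 ->]].
  exists (\col_j c (enum_val j)); first by move=> j; rewrite mxE.
  by rewrite GE; apply: eq_bigr => i _; rewrite mxE enum_rankK.
by exists (fun i => c (enum_rank i) 0); rewrite ?GE.
Qed.

(** [msize] is the degree plus one, so each monomial is a product of three homogeneous coordinates;
    [T] is the sum of their polarizations, weighted by the coefficients. *)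
Lemma peval_cubic_form (R : realType) (n : nat) (f : {mpoly R[n]}) : (msize f <= 4)%N ->
  exists2 T, symmetric_trilinear T &
    forall x, peval f x = T (homogenize x) (homogenize x) (homogenize x).
Proof.
move=> f4.
have /choice[t Ht] : forall m : 'X_{1..n}, exists t : 'I_(n + 1) * 'I_(n + 1) * 'I_(n + 1),
    m \in msupp f -> forall x : 'cV[R]_n, \prod_i x i 0 ^+ m i =
      homogenize x t.1.1 0 * homogenize x t.1.2 0 * homogenize x t.2 0.
  move=> m; have [mf|_] := boolP (m \in msupp f); last first.
    by exists (rshift n ord0, rshift n ord0, rshift n ord0).
  have /(monomial_homogenize R)[[|a [|b [|c []]]] // _ Hs] : (mdeg m <= 3)%N.
    by have := leq_trans (msize_mdeg_lt mf) f4.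
  by exists (a, b, c) => _ x; rewrite Hs !big_cons big_nil mulr1 mulrA.
exists (fun u v w => \sum_(m <- msupp f)
    f@_m * sym_prod (t m).1.1 (t m).1.2 (t m).2 u v w).
  by apply: symmetric_trilinear_sum => m; apply: sym_prod_trilinear.
move=> x; rewrite /peval mevalE; apply: eq_big_seq => m mf.
by rewrite sym_prod_diag -Ht.
Qed.

(** * Transfer between the polyhedron and the slice *)

Theorem theorem7 (R : realType) (n : nat) (P : 'cV[R]_n -> Prop)
    (f : {mpoly R[n]}) :
  is_polyhedron P ->
  (msize f <= 4)%N ->
  unbounded_on f P ->
  exists x d, [/\ P x, rec_cone P d, d != 0 & unbounded_on f (ray x d)].
Proof.
move=> [m [A [b PE]]] /peval_cubic_form[T symT fT] unb.
apply: contrapT => noray.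
(* The constraints [- t <= 0] and [A x - t b <= 0] define a cone whose slice [t = 1] is [P]. *)
pose s := row_mx 0 (- 1%:M) :: [seq row_mx (row i A) (- (b i 0)%:M) | i <- enum 'I_m].
have sE (x : 'cV[R]_n) (t : R) : (forall a, a \in s -> (a *m col_mx x t%:M) 0 0 <= 0) <->
    0 <= t /\ forall i, (A *m x) i 0 <= t * b i 0.
  have rowE i : (row_mx (row i A) (- (b i 0)%:M) *m col_mx x t%:M) 0 0 =
      (A *m x) i 0 - t * b i 0.
    by rewrite mul_row_col -row_mul mulNmx -scalar_mxM !mxE eqxx mulr1n mulrC.
  have topE : (row_mx 0 (- 1%:M) *m col_mx x t%:M) 0 0 = - t.
    by rewrite mul_row_col mul0mx add0r mulNmx mul1mx !mxE eqxx mulr1n.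
  split=> [H|[t0 H] a].
    split=> [|i]; first by rewrite -oppr_le0 -topE; apply: H; rewrite inE eqxx.
    rewrite -subr_le0 -rowE; apply: H.
    by rewrite inE; apply/orP; right; apply/mapP; exists i; rewrite ?mem_enum.
  rewrite inE => /orP[/eqP ->|/mapP[i _ ->]]; first by rewrite topE oppr_le0.
  by rewrite rowE subr_le0.
have [N [G HG]] := finitely_generated_cone_mx s.
(* The upper block of [G] gives the point [x]; its last row gives the height [t] and serves as
   [tau]. *)
have GE (c : 'cV[R]_N) : G *m c = col_mx (usubmx G *m c) ((dsubmx G *m c) 0 0)%:M.
  by rewrite -mx11_scalar -mul_col_mx vsubmxK.
have Gs c : nonneg c -> 0 <= (dsubmx G *m c) 0 0 /\
    forall i, (A *m (usubmx G *m c)) i 0 <= (dsubmx G *m c) 0 0 * b i 0.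
  by move=> c0; apply/sE; rewrite -GE; apply/HG; exists c.
pose T' (u v w : 'cV[R]_N) := T (G *m u) (G *m v) (G *m w).
have symT' : symmetric_trilinear T'.
  exact: (symmetric_trilinear_comp (mulmx G)).
have T'E c : (dsubmx G *m c) 0 0 = 1 -> peval f (usubmx G *m c) = T' c c c.
  by move=> c1; rewrite fT /T' GE c1.
have [||M HM] := cubic_form_bounded (tau := dsubmx G) symT'.
- move=> j; have [|+ _] := Gs (delta_mx j 0).
    by move=> i; rewrite mxE ler0n.
  by rewrite -colE mxE.
(* Height 1 maps [c] into [P] and height 0 maps [d] to a recession direction, so an unbounded ray of
   the slice would yield a forbidden ray of [P]. *)
- move=> c d c0 c1 d0 d1; apply: contrapT => /forallNP unbounded; apply: noray.
  have unb' : unbounded_on f (ray (usubmx G *m c) (usubmx G *m d)).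
    move=> M; have /existsNP[x /not_implyP[x0 /negP]] := unbounded M.
    rewrite -ltNge => Hx; exists (usubmx G *m c + x *: (usubmx G *m d)); first by exists x.
    by rewrite scalemxAr -mulmxDr T'E // tauD tauZ c1 d1 mulr0 addr0.
  exists (usubmx G *m c), (usubmx G *m d); split=> //.
  + by apply/PE => i; have [_ /(_ i)] := Gs c c0; rewrite c1 mul1r.
  + move=> x /PE Px l l0; apply/PE => i; rewrite mulmxDr -scalemxAr mxE.
    rewrite -[leRHS]addr0 lerD // mxE mulr_ge0_le0 //.
    by have [_ /(_ i)] := Gs d d0; rewrite d1 mul0r.
  (* If [d] were mapped to [0], [f] would be constant on the ray. *)
  + apply/eqP => d00; have [y [x _ ->]] := unb' (peval f (usubmx G *m c)).
    by rewrite d00 scaler0 addr0 ltxx.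
have [x Px Mx] := unb M.
have [c c0 cE] : exists2 c, nonneg c & homogenize x = G *m c.
  apply/HG/sE; split=> // i; rewrite mul1r.
  by have /PE := Px.
have [xE tE] : x = usubmx G *m c /\ (1%:M : 'M[R]_1) = dsubmx G *m c.
  by apply: eq_col_mx; rewrite -mul_col_mx vsubmxK.
have c1 : (dsubmx G *m c) 0 0 = 1 by rewrite -tE mxE.
by have := HM c c0 c1; rewrite -T'E // -xE leNgt Mx.
Qed.
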